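(* Let $L/K$ be a separable field extension of degree $g$. Let $(\mathcal{H},\mu)$ be an almost classically Galois structure on $L/K$ and let $(\mathcal{H}',\mu')$ be a Hopf Galois structure on $L/K$. If the Hopf algebras $\mathcal{H}$ and $\mathcal{H}'$ are isomorphic as $K$-Hopf algebras, then the Hopf Galois structures $(\mathcal{H},\mu)$ and $(\mathcal{H}',\mu')$ are isomorphic. Hence an almost classically Galois structure stands alone in its Hopf algebra isomorphism class (that is, up to isomorphism it is the unique Hopf Galois structure on $L/K$ whose underlying Hopf algebra is $K$-isomorphic to $\mathcal{H}$).
   Context: A Hopf Galois structure on a finite field extension $L/K$ is a pair $(H,\mu)$, where $H$ is a finite cocommutative $K$-Hopf algebra and $\mu: H\to \operatorname{End}_K(L)$ is a $K$-linear map giving $L$ a left $H$-module algebra structure and inducing a $K$-vector space isomorphism $L\otimes_K H\to \operatorname{End}_K(L)$. Two Hopf Galois structures $(H,\mu)$ and $(H',\mu')$ on $L/K$ are isomorphic if there is a $K$-Hopf algebra isomorphism $f:H\to H'$ with $\mu'\circ f=\mu$. Let $L/K$ be separable of degree $g$, $\widetilde{L}$ its Galois closure, $G=\mathrm{Gal}(\widetilde{L}/K)$, $G'=\mathrm{Gal}(\widetilde{L}/L)$, and let $\lambda:G\hookrightarrow S_g=\mathrm{Sym}(G/G')$ be given by the action of $G$ on the left cosets $G/G'$. By the Greither–Pareigis theorem, isomorphism classes of Hopf Galois structures on $L/K$ are in bijection with regular subgroups $N$ of $S_g$ normalized by $\lambda(G)$. The Hopf algebra corresponding to $N$ is $\widetilde{L}[N]^G$,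 the sub-$K$-Hopf algebra of the group algebra $\widetilde{L}[N]$ fixed by $G$, where $G$ acts on $\widetilde{L}$ by $K$-automorphisms and on $N$ by conjugation through $\lambda$; the Hopf action is induced by $n\mapsto n^{-1}(\overline{1})$ for $n\in N$, where $\overline{1}$ is the class of $1_G$ in $G/G'$, i.e. $(\sum_n c_n n)\cdot x=\sum_n c_n\,\big(n^{-1}(\overline{1})\big)(x)$ for $x\in L$. A Hopf Galois structure on $L/K$ is called almost classically Galois if the corresponding regular subgroup $N$ of $S_g$ has the property that its centralizer $Z_{S_g}(N)$ in $S_g$ is contained in $\lambda(G)$. *)

(* Defs.v *)
From HB Require Import structures.
From mathcomp Require Import all_boot all_order all_fingroup all_algebra.
From mathcomp Require Import all_solvable all_field.

Set Implicit Arguments.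
Unset Strict Implicit.
Unset Printing Implicit Defensive.

Import GRing.Theory.
Local Open Scope ring_scope.

(* Tensor products of finite dimensional vector spaces. U (x) V is modelled   *)
(* by coordinate matrices with respect to the bases vbasis {:U}, vbasis {:V}. *)
(* The model is only ever used through tens, tlift_for and their universal    *)
(* property (tens_bilinear, tlift_forE, tlift_for_uniq).                      *)
Section Tensor.

Definition tensor (K : fieldType) (U V : vectType K) : vectType K :=
  'M[K]_(\dim {:U}, \dim {:V}).

Variables (K : fieldType) (U V : vectType K).

Definition tens (u : U) (v : V) : tensor U V :=
  \matrix_(i, j) (coord (vbasis {:U}) i u * coord (vbasis {:V}) j v).

(* The nu-semilinear map U (x) V -> W sending u (x) v to f u v, for f         *)
(* additive and nu-semilinear in each argument.                               *)
Definition tlift_for (R : nzRingType) (nu : {rmorphism K -> R})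
    (W : lmodType R) (f : U -> V -> W) (t : tensor U V) : W :=
  \sum_i \sum_j
    nu (t i j) *: f (tnth (vbasis {:U}) i) (tnth (vbasis {:V}) j).

Lemma tens_bilinear :
  (forall u, linear (tens u)) /\ (forall v, linear (tens^~ v)).
Proof.
split=> [u a v v'|v a u u']; apply/matrixP=> i j; rewrite !mxE linearP /=.
  by rewrite mulrDr mulrCA.
by rewrite mulrDl mulrA.
Qed.

Section Lift.
Variables (R : nzRingType) (nu : {rmorphism K -> R}) (W : lmodType R).

Lemma tlift_for_linear (f : U -> V -> W) a t t' :
  tlift_for nu f (a *: t + t') = nu a *: tlift_for nu f t + tlift_for nu f t'.
Proof.
rewrite /tlift_for scaler_sumr -big_split; apply: eq_bigr => i _ /=.
rewrite scaler_sumr -big_split; apply: eq_bigr => j _ /=.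
by rewrite !mxE rmorphD rmorphM scalerDl scalerA.
Qed.

Lemma tlift_forE (f : U -> V -> W)
    (fl : forall v a u u', f (a *: u + u') v = nu a *: f u v + f u' v)
    (fr : forall u a v v', f u (a *: v + v') = nu a *: f u v + f u v') u v :
  tlift_for nu f (tens u v) = f u v.
Proof.
have f0l w : f 0 w = 0.
  by have := fl w (-1) 0 0; rewrite scaler0 addr0 rmorphN1 scaleN1r addNr.
have f0r w : f w 0 = 0.
  by have := fr w (-1) 0 0; rewrite scaler0 addr0 rmorphN1 scaleN1r addNr.
have fsl w n (c : 'I_n -> K) (x : 'I_n -> U) :
    f (\sum_i c i *: x i) w = \sum_i nu (c i) *: f (x i) w.
  elim: n c x => [|n IHn] c x; first by rewrite !big_ord0 f0l.
  by rewrite !big_ord_recl fl IHn.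
have fsr w n (c : 'I_n -> K) (x : 'I_n -> V) :
    f w (\sum_i c i *: x i) = \sum_i nu (c i) *: f w (x i).
  elim: n c x => [|n IHn] c x; first by rewrite !big_ord0 f0r.
  by rewrite !big_ord_recl fr IHn.
rewrite [in RHS](coord_vbasis (memvf u)) [in RHS](coord_vbasis (memvf v)).
rewrite fsl; apply: eq_bigr => i _; rewrite fsr scaler_sumr.
apply: eq_bigr => j _.
by rewrite scalerA -rmorphM mxE -!tnth_nth.
Qed.

Lemma tlift_for_uniq (g : tensor U V -> W)
    (gl : forall a t t', g (a *: t + t') = nu a *: g t + g t') t :
  g t = tlift_for nu (fun u v => g (tens u v)) t.
Proof.
have g0 : g 0 = 0.
  by have := gl (-1) 0 0; rewrite scaler0 addr0 rmorphN1 scaleN1r addNr.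
have gD x y : g (x + y) = g x + g y.
  by have := gl 1 x y; rewrite scale1r rmorph1 scale1r.
have gZ a x : g (a *: x) = nu a *: g x.
  by have := gl a x 0; rewrite !addr0 g0 addr0.
rewrite {1}(matrix_sum_delta t) /tlift_for.
rewrite (big_morph g gD g0); apply: eq_bigr => i _.
rewrite (big_morph g gD g0); apply: eq_bigr => j _.
rewrite gZ; congr (_ *: g _); apply/matrixP=> i' j'; rewrite !mxE.
rewrite !(tnth_nth 0) !coord_free ?(basis_free (vbasisP _)) //.
by rewrite -natrM mulnb [i == i']eq_sym [j == j']eq_sym.
Qed.

End Lift.
End Tensor.

Notation tlift := (tlift_for idfun).

Section TensorMaps.
Variable K : fieldType.

Definition tmap (U V U' V' : vectType K) (f : U -> U') (g : V -> V')
    : tensor U V -> tensor U' V' :=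
  tlift (fun u v => tens (f u) (g v)).

Definition tassoc (U V W : vectType K)
    : tensor (tensor U V) W -> tensor U (tensor V W) :=
  tlift (fun t w => tlift (fun u v => tens u (tens v w)) t).

Definition tswap (U V : vectType K) : tensor U V -> tensor V U :=
  tlift (fun u v => tens v u).

(* (a (x) b) (c (x) d) = (a * c) (x) (b * d) *)
Definition tmul (A B : falgType K) (s t : tensor A B) : tensor A B :=
  tlift (fun a b => tlift (fun c d => tens (a * c) (b * d)) t) s.

End TensorMaps.

(* tlift (fun a b => F a b) (comul h) is the Sweedler sum of F h_(1) h_(2).   *)
HB.mixin Record Falgebra_isHopf (K : fieldType) H of Falgebra K H := {
  comul : {linear H -> tensor H H};
  counit : {linear H -> K^o};
  antipode : {linear H -> H};
  comul_coassoc : forall h : H,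
    tassoc (tmap comul id (comul h)) = tmap id comul (comul h);
  counit_l : forall h : H, tlift (fun a b : H => counit a *: b) (comul h) = h;
  counit_r : forall h : H, tlift (fun a b : H => counit b *: a) (comul h) = h;
  comul1 : comul 1 = tens 1 1;
  comulM : forall a b : H, comul (a * b) = tmul (comul a) (comul b);
  counit1 : counit 1 = 1;
  counitM : forall a b : H, counit (a * b) = counit a * counit b;
  antipode_l : forall h : H,
    tlift (fun a b : H => antipode a * b) (comul h) = (counit h)%:A;
  antipode_r : forall h : H,
    tlift (fun a b : H => a * antipode b) (comul h) = (counit h)%:A
}.

(* Finite dimensional Hopf algebras. *)
#[short(type="hopfType")]
HB.structure Definition Hopf (K : fieldType) :=
  { H of Falgebra K H & Falgebra_isHopf K H }.

Section HopfGalois.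
Variable K : fieldType.

Definition cocommutative (H : hopfType K) :=
  forall h : H, tswap (comul h) = comul h.

Record is_hopf_iso (H H' : hopfType K) (f : {lrmorphism H -> H'}) : Prop :=
  IsHopfIso {
    hopf_iso_bij : bijective f;
    hopf_iso_comul : forall h, comul (f h) = tmap f f (comul h);
    hopf_iso_counit : forall h, counit (f h) = counit h :> K;
    hopf_iso_antipode : forall h, antipode (f h) = f (antipode h)
  }.

Definition hopf_isomorphic (H H' : hopfType K) : Prop :=
  exists f : {lrmorphism H -> H'}, is_hopf_iso f.

Variable L : fieldExtType K.

Record hopf_galois_structure := HopfGaloisStructure {
  hgs_alg :> hopfType K;
  hgs_act : {linear hgs_alg -> 'End(L)};
  hgs_cocomm : cocommutative hgs_alg;
  hgs_act1 : hgs_act 1 = \1%VF;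
  hgs_actM : forall h k, hgs_act (h * k) = (hgs_act h \o hgs_act k)%VF;
  hgs_act_one : forall h, hgs_act h 1 = (counit h)%:A;
  hgs_act_mul : forall h (x y : L),
    hgs_act h (x * y) =
      tlift (fun h1 h2 => hgs_act h1 x * hgs_act h2 y) (comul h);
  (* x (x) h |-> (y |-> x * (h . y)) *)
  hgs_bij : bijective (tlift (fun (x : L) (h : hgs_alg) =>
                                (amull x \o hgs_act h)%VF) :
                         tensor L hgs_alg -> 'End(L))
}.

Definition hgs_isomorphic (S S' : hopf_galois_structure) : Prop :=
  exists f : {lrmorphism S -> S'},
    is_hopf_iso f /\ forall h, hgs_act S' (f h) = hgs_act S h.

End HopfGalois.

(* The group algebra R[N] of a permutation group N, in which the product of   *)
(* s and t in N is the composite s \o t (apply t first). As the product of    *)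
(* {perm T} is in reading order, s \o t is t * s.                             *)
Section PermAlgebra.

Definition permalg (R : fieldType) (T : finType) (N : {group {perm T}}) :=
  {ffun subg_of N -> R^o}.

Variables (R : fieldType) (T : finType) (N : {group {perm T}}).
Local Notation A := (permalg R N).

HB.instance Definition _ := Vector.copy A {ffun subg_of N -> R^o}.

Definition pbasis (n : subg_of N) : A := [ffun m => (m == n)%:R].

Definition palg_one : A := pbasis 1%g.
Definition palg_mul (c d : A) : A :=
  [ffun n => \sum_m c m * d (n * m^-1)%g].

Lemma palg_sum (c : A) : c = \sum_n c n *: pbasis n.
Proof.
apply/ffunP=> m; rewrite sum_ffunE (bigD1 m) //= !ffunE eqxx.
rewrite big1 ?addr0 => [|n nm]; first by rewrite /GRing.scale /= mulr1.
by rewrite !ffunE eq_sym (negPf nm) /GRing.scale /= mulr0.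
Qed.

Fact palg_mulA : associative palg_mul.
Proof.
move=> c d e; apply/ffunP=> n; rewrite !ffunE.
under [RHS]eq_bigr => m _ do rewrite ffunE mulr_suml.
rewrite exchange_big; apply: eq_bigr => p _ /=.
rewrite ffunE mulr_sumr (reindex_inj (mulIg p^-1%g)) /=.
by apply: eq_bigr => m _; rewrite mulrA invMg invgK !mulgA mulgKV.
Qed.

Fact palg_mul1l : left_id palg_one palg_mul.
Proof.
move=> c; apply/ffunP=> n; rewrite !ffunE (bigD1 1%g) //= ffunE eqxx mul1r.
rewrite invg1 mulg1 big1 ?addr0 // => m m1.
by rewrite ffunE (negPf m1) mul0r.
Qed.

Fact palg_mul1r : right_id palg_one palg_mul.
Proof.
move=> c; apply/ffunP=> n; rewrite !ffunE (bigD1 n) //= ffunE mulgV eqxx mulr1.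
rewrite big1 ?addr0 // => m mn.
by rewrite ffunE -eq_mulgV1 eq_sym (negPf mn) mulr0.
Qed.

Fact palg_mulDl : left_distributive palg_mul +%R.
Proof.
move=> c d e; apply/ffunP=> n; rewrite !ffunE -big_split.
by apply: eq_bigr => m _; rewrite ffunE mulrDl.
Qed.

Fact palg_mulDr : right_distributive palg_mul +%R.
Proof.
move=> c d e; apply/ffunP=> n; rewrite !ffunE -big_split.
by apply: eq_bigr => m _; rewrite ffunE mulrDr.
Qed.

Fact palg_one_neq0 : palg_one != 0.
Proof.
by apply/eqP=> /ffunP/(_ 1%g)/eqP; rewrite !ffunE eqxx oner_eq0.
Qed.

HB.instance Definition _ := GRing.Zmodule_isNzRing.Build A
  palg_mulA palg_mul1l palg_mul1r palg_mulDl palg_mulDr palg_one_neq0.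

Lemma palg_mulE (c d : A) n : (c * d) n = \sum_m c m * d (n * m^-1)%g.
Proof. by rewrite ffunE. Qed.

Lemma palg_scaleE a (c : A) n : (a *: c) n = a * c n.
Proof. by rewrite ffunE. Qed.

Fact palg_scaleAl a (c d : A) : a *: (c * d) = (a *: c) * d.
Proof.
apply/ffunP=> n; rewrite palg_scaleE !palg_mulE mulr_sumr.
by apply: eq_bigr => m _; rewrite palg_scaleE mulrA.
Qed.

HB.instance Definition _ := GRing.Lmodule_isLalgebra.Build R A palg_scaleAl.

Fact palg_scaleAr a (c d : A) : a *: (c * d) = c * (a *: d).
Proof.
apply/ffunP=> n; rewrite palg_scaleE !palg_mulE mulr_sumr.
by apply: eq_bigr => m _; rewrite palg_scaleE mulrCA.
Qed.

HB.instance Definition _ := GRing.Lalgebra_isAlgebra.Build R A palg_scaleAr.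
HB.instance Definition _ := Algebra_isFalgebra.Build R A.

Lemma pbasis1 : pbasis 1%g = 1. Proof. by []. Qed.

Lemma pbasisM s t : pbasis s * pbasis t = pbasis (t * s)%g.
Proof.
apply/ffunP=> n; rewrite palg_mulE (bigD1 s) //= !ffunE eqxx mul1r.
rewrite big1 ?addr0 => [|m ms]; last by rewrite ffunE (negPf ms) mul0r.
by rewrite -(inj_eq (mulIg s)) mulgKV.
Qed.

Definition palg_comul (c : A) : tensor A A :=
  \sum_n c n *: tens (pbasis n) (pbasis n).
Definition palg_counit (c : A) : R^o := \sum_n c n.
Definition palg_antipode (c : A) : A := \sum_n c n *: pbasis n^-1%g.


Lemma palg_ext (W : lmodType R) (f g : A -> W) :
  linear f -> linear g -> (forall n, f (pbasis n) = g (pbasis n)) -> f =1 g.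
Proof.
move=> fl gl fg c; rewrite (palg_sum c).
have lin (h : A -> W) : linear h -> (h 0 = 0) * {morph h : x y / x + y} *
    (forall a x, h (a *: x) = a *: h x).
  move=> hl; have h0 : h 0 = 0.
    by have := hl (-1) 0 0; rewrite scaler0 addr0 scaleN1r addNr.
  split=> [|a x]; first split=> // x y.
    by have := hl 1 x y; rewrite !scale1r.
  by have := hl a x 0; rewrite !addr0 h0 addr0.
rewrite (big_morph f (lin f fl).1.2 (lin f fl).1.1).
rewrite (big_morph g (lin g gl).1.2 (lin g gl).1.1).
by apply: eq_bigr => n _; rewrite (lin f fl).2 (lin g gl).2 fg.
Qed.

Lemma palg_sum_linear (W : lmodType R) (w : subg_of N -> W) :
  linear (fun c : A => \sum_n c n *: w n).
Proof.
move=> a c d; rewrite scaler_sumr -big_split; apply: eq_bigr => n _ /=.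
by rewrite !ffunE scalerDl scalerA.
Qed.

Lemma palg_sum_pbasis (W : lmodType R) (w : subg_of N -> W) n :
  \sum_m pbasis n m *: w m = w n.
Proof.
rewrite (bigD1 n) //= ffunE eqxx scale1r big1 ?addr0 // => m mn.
by rewrite ffunE (negPf mn) scale0r.
Qed.

Fact palg_comul_linear : linear palg_comul.
Proof. exact: palg_sum_linear. Qed.
Fact palg_counit_linear : linear palg_counit.
Proof.
move=> a c d; rewrite /palg_counit scaler_sumr -big_split.
by apply: eq_bigr => n _ /=; rewrite !ffunE.
Qed.
Fact palg_antipode_linear : linear palg_antipode.
Proof. exact: palg_sum_linear. Qed.

HB.instance Definition _ := GRing.isLinear.Build R A (tensor A A) _
  palg_comul palg_comul_linear.
HB.instance Definition _ := GRing.isLinear.Build R A R^o _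
  palg_counit palg_counit_linear.
HB.instance Definition _ := GRing.isLinear.Build R A A _
  palg_antipode palg_antipode_linear.

Lemma palg_comul_pbasis n :
  palg_comul (pbasis n) = tens (pbasis n) (pbasis n).
Proof. exact: palg_sum_pbasis. Qed.

Lemma palg_counit_pbasis n : palg_counit (pbasis n) = 1.
Proof.
rewrite /palg_counit (bigD1 n) //= ffunE eqxx big1 ?addr0 // => m mn.
by rewrite ffunE (negPf mn).
Qed.

Lemma palg_antipode_pbasis n : palg_antipode (pbasis n) = pbasis n^-1%g.
Proof. exact: palg_sum_pbasis. Qed.

Definition palgE := (palg_comul_pbasis, palg_counit_pbasis,
  palg_antipode_pbasis, pbasisM).

Lemma tliftE (U V : vectType R) (W : lmodType R) (f : U -> V -> W) u v :
  (forall v, linear (f^~ v)) -> (forall u, linear (f u)) ->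
  tlift f (tens u v) = f u v.
Proof.
by move=> fl fr; apply: tlift_forE => *; [apply: fl|apply: fr].
Qed.

Lemma tlift_comul (W : lmodType R) (f : A -> A -> W) n :
  (forall v, linear (f^~ v)) -> (forall u, linear (f u)) ->
  tlift f (palg_comul (pbasis n)) = f (pbasis n) (pbasis n).
Proof. by move=> fl fr; rewrite palg_comul_pbasis tliftE. Qed.

Lemma tlift_linear (U V : vectType R) (W : lmodType R) (f : U -> V -> W) :
  linear (tlift f).
Proof. exact: tlift_for_linear. Qed.

Lemma tlift_param (U V : vectType R) (X W : lmodType R)
    (F : X -> U -> V -> W) t :
  (forall u v, linear (fun x => F x u v)) -> linear (fun x => tlift (F x) t).
Proof.
move=> Fl a x y; rewrite /tlift_for scaler_sumr -big_split.
apply: eq_bigr => i _ /=; rewrite scaler_sumr -big_split.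
apply: eq_bigr => j _ /=.
by rewrite Fl scalerDr !scalerA mulrC.
Qed.

Lemma tens_linl (U V : vectType R) (v : V) : linear (fun u : U => tens u v).
Proof. exact: (tens_bilinear U V).2. Qed.

Lemma tens_linr (U V : vectType R) (u : U) : linear (tens u : V -> _).
Proof. exact: (tens_bilinear U V).1. Qed.

Lemma mul_linl (c : A) : linear (fun d : A => d * c).
Proof. by move=> a x y; rewrite mulrDl scalerAl. Qed.

Lemma mul_linr (c : A) : linear (fun d : A => c * d).
Proof. by move=> a x y; rewrite mulrDr scalerAr. Qed.

Lemma scale_linl (W : lmodType R) (w : W) : linear (fun a : R^o => a *: w).
Proof. by move=> a x y; rewrite scalerDl scalerA. Qed.

Lemma scale_linr (W : lmodType R) (b : R) : linear (fun w : W => b *: w).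
Proof. by move=> a x y; rewrite scalerDr !scalerA mulrC. Qed.

Lemma lin_comp (U V W : lmodType R) (f : V -> W) (g : U -> V) :
  linear f -> linear g -> linear (fun x => f (g x)).
Proof. by move=> fl gl a x y; rewrite gl fl. Qed.

Let comul_lin := palg_comul_linear.
Let counit_lin := palg_counit_linear.
Let antip_lin := palg_antipode_linear.

Fact palg_coassoc c :
  tassoc (tmap palg_comul id (palg_comul c)) =
  tmap id palg_comul (palg_comul c).
Proof.
move: c; apply: palg_ext => [||n].
- by do 2?[apply: lin_comp; first exact: tlift_linear].
- by apply: lin_comp; first exact: tlift_linear.
rewrite /tmap !tlift_comul.
- rewrite palg_comul_pbasis /tassoc tliftE.
  + by rewrite tliftE // => *; [apply: tens_linl
      | apply: lin_comp; [exact: tens_linr | exact: tens_linl]].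
  + by move=> v; exact: tlift_linear.
  move=> u; apply: tlift_param => u' v' a x y.
  by rewrite !tens_linr.
all: by move=> u; first [exact: tens_linl | exact: tens_linr
  | exact: (lin_comp (tens_linl _) comul_lin)
  | exact: (lin_comp (tens_linr _) comul_lin)].
Qed.

Fact palg_counit_l c :
  tlift (fun a b : A => palg_counit a *: b) (palg_comul c) = c.
Proof.
move: c; apply: palg_ext => [||n].
- by exact: (lin_comp (@tlift_linear _ _ _ _) comul_lin).
- by [].
rewrite tlift_comul ?palgE ?scale1r // => u.
- exact: (lin_comp (scale_linl _) counit_lin).
exact: scale_linr.
Qed.

Fact palg_counit_r c :
  tlift (fun a b : A => palg_counit b *: a) (palg_comul c) = c.
Proof.
move: c; apply: palg_ext => [||n].
- by exact: (lin_comp (@tlift_linear _ _ _ _) comul_lin).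
- by [].
rewrite tlift_comul ?palgE ?scale1r // => u.
- exact: scale_linr.
exact: (lin_comp (scale_linl _) counit_lin).
Qed.

Fact palg_comul1 : palg_comul 1 = tens 1 1.
Proof. by rewrite -pbasis1 palgE. Qed.

Lemma tmul_linl (t : tensor A A) : linear (fun s : tensor A A => tmul s t).
Proof. exact: tlift_linear. Qed.

Lemma tmul_linr (s : tensor A A) : linear (tmul s).
Proof. by apply: tlift_param => u v; exact: tlift_linear. Qed.

Lemma tmulE (a b c d : A) :
  tmul (tens a b) (tens c d) = tens (a * c) (b * d).
Proof.
rewrite /tmul tliftE.
- rewrite tliftE // => w.
    exact: (lin_comp (tens_linl _) (mul_linr _)).
  exact: (lin_comp (tens_linr _) (mul_linr _)).
- move=> v; apply: tlift_param => u' v'.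
  exact: (lin_comp (tens_linl _) (mul_linl _)).
move=> v; apply: tlift_param => u' v'.
exact: (lin_comp (tens_linr _) (mul_linl _)).
Qed.

Fact palg_comulM c d :
  palg_comul (c * d) = tmul (palg_comul c) (palg_comul d).
Proof.
move: c; apply: palg_ext => [||m].
- exact: (lin_comp comul_lin (mul_linl _)).
- exact: (lin_comp (tmul_linl _) comul_lin).
move: d; apply: palg_ext => [||n].
- exact: (lin_comp comul_lin (mul_linr _)).
- exact: (lin_comp (tmul_linr _) comul_lin).
by rewrite !palgE tmulE !palgE.
Qed.

Fact palg_counit1 : palg_counit 1 = 1.
Proof. by rewrite -pbasis1 palgE. Qed.

Fact palg_counitM c d : palg_counit (c * d) = palg_counit c * palg_counit d.
Proof.
move: c; apply: palg_ext => [||m].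
- exact: (lin_comp counit_lin (mul_linl _)).
- exact: (lin_comp (scale_linl _) counit_lin).
move: d; apply: palg_ext => [||n].
- exact: (lin_comp counit_lin (mul_linr _)).
- exact: (lin_comp (scale_linr _) counit_lin).
by rewrite !palgE mulr1.
Qed.

Fact palg_antipode_l c :
  tlift (fun a b : A => palg_antipode a * b) (palg_comul c) =
  (palg_counit c)%:A.
Proof.
move: c; apply: palg_ext => [||n].
- by exact: (lin_comp (@tlift_linear _ _ _ _) comul_lin).
- exact: (lin_comp (scale_linl _) counit_lin).
rewrite tlift_comul ?palgE ?scale1r ?mulgV //.
- by move=> v; exact: (lin_comp (mul_linl _) antip_lin).
by move=> u; exact: mul_linr.
Qed.

Fact palg_antipode_r c :
  tlift (fun a b : A => a * palg_antipode b) (palg_comul c) =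
  (palg_counit c)%:A.
Proof.
move: c; apply: palg_ext => [||n].
- by exact: (lin_comp (@tlift_linear _ _ _ _) comul_lin).
- exact: (lin_comp (scale_linl _) counit_lin).
rewrite tlift_comul ?palgE ?scale1r ?mulVg //.
- by move=> v; exact: mul_linl.
by move=> u; exact: (lin_comp (mul_linr _) antip_lin).
Qed.

HB.instance Definition _ := Falgebra_isHopf.Build R A
  palg_coassoc palg_counit_l palg_counit_r palg_comul1 palg_comulM
  palg_counit1 palg_counitM palg_antipode_l palg_antipode_r.

End PermAlgebra.

Section GreitherPareigis.
Variables (K : fieldType) (L : fieldExtType K).
Variables (Lt : splittingFieldType K) (iota : 'AHom(L, Lt)).
Local Notation G := (gal_of {:Lt}).

Definition is_galois_closure : Prop :=
  galois 1 {:Lt} /\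
  forall E : {subfield Lt},
    (iota @: {:L} <= E)%VS -> galois 1 E -> E = {:Lt}%AS.

(* G', the automorphisms fixing the image of L in Lt.                         *)
Definition stabL : {group G} := 'Gal({:Lt} / iota @: {:L})%G.

(* G/G'. The product of gal_of is in reading order, x * y = y \o x, so the    *)
(* coset { s \o t | t in G' } of s is the set stabL :* s.                     *)
Definition coset_space : finType :=
  {X : {set G} | X \in rcosets stabL [set: G]}.

Fact base_coset_subproof : (stabL : {set G}) \in rcosets stabL [set: G].
Proof. by apply/rcosetsP; exists 1%g; rewrite ?inE ?rcoset1. Qed.
Definition base_coset : coset_space :=
  Sub (stabL : {set G}) base_coset_subproof.

Fact coset_mul_subproof (s : G) (X : coset_space) :
  (val X :* s)%g \in rcosets stabL [set: G].
Proof.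
by case/rcosetsP: (valP X) => t _ ->; apply/rcosetsP; exists (t * s)%g;
  rewrite ?inE ?rcosetM.
Qed.

(* left translation [t] |-> [s \o t] of G/G'                                  *)
Definition coset_mul (s : G) (X : coset_space) : coset_space :=
  Sub (val X :* s)%g (coset_mul_subproof s X).

Fact coset_mul_inj s : injective (coset_mul s).
Proof.
move=> X Y /(congr1 val)/= /(congr1 (fun Z => (Z :* s^-1)%g)).
by rewrite -!rcosetM mulgV !rcoset1 => /val_inj.
Qed.

Definition lambda (s : G) : {perm coset_space} := perm (@coset_mul_inj s).

Lemma lambdaM : {morph lambda : s t / (s * t)%g}.
Proof.
by move=> s t; apply/permP=> X; rewrite permM !permE; apply: val_inj;
  rewrite /= rcosetM.
Qed.

Definition lambdaG : {set {perm coset_space}} := lambda @: [set: G].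

(* A class of G/G' as a K-embedding L -> Lt.                                  *)
Definition coset_eval (X : coset_space) (x : L) : Lt := repr (val X) (iota x).

Lemma coset_evalE (X : coset_space) (s : G) x :
  s \in val X -> coset_eval X x = s (iota x).
Proof.
case/rcosetsP: (valP X) => t _ XE sX; rewrite /coset_eval.
have ev r : r \in val X -> r (iota x) = t (iota x).
  rewrite XE => /rcosetP[u uG' ->]; rewrite galM ?memvf //.
  by rewrite (fixed_gal _ uG') ?subvf // memv_img ?memvf.
by rewrite (ev _ sX) ev // (mem_repr s).
Qed.

Definition regular_perm (N : {group {perm coset_space}}) : bool :=
  [transitive N, on [set: coset_space] | 'P] &&
  [forall X : coset_space, ('C_N[X | 'P] == 1)%g].

(* The semilinear action of G on Lt[N] for which s maps n to                  *)
(* lambda s \o n \o (lambda s)^-1, that is, to n ^ lambda s. The projection   *)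
(* subg is harmless as soon as lambdaG normalises N.                          *)
Definition gp_act (N : {group {perm coset_space}}) (s : G) (c : permalg Lt N)
    : permalg Lt N :=
  \sum_n s (c n) *: pbasis Lt (subg N (sgval n ^ lambda s)%g).

(* phi is an isomorphism from the K-Hopf algebra of S onto the sub-K-Hopf     *)
(* algebra Lt[N]^G of the Lt-Hopf algebra Lt[N], and carries the action of S  *)
(* to (\sum_n c_n n) . x = \sum_n c_n (n^-1 base_coset)(x). The               *)
(* comultiplication on Lt[N]^G is the one that the canonical map             *)
(* Lt[N]^G (x)_K Lt[N]^G -> Lt[N] (x)_Lt Lt[N] takes to that of Lt[N].        *)
Record is_gp_iso (S : hopf_galois_structure L) (N : {group {perm coset_space}})
    (phi : {lrmorphism S -> permalg Lt N | in_alg Lt \; *:%R}) : Prop :=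
  IsGPIso {
    gp_inj : injective phi;
    gp_image : forall c, (exists h, phi h = c) <-> (forall s, gp_act s c = c);
    gp_comul : forall h, comul (phi h) =
      tlift_for (in_alg Lt) (fun a b => tens (phi a) (phi b)) (comul h);
    gp_counit : forall h, counit (phi h) = in_alg Lt (counit h);
    gp_antipode : forall h, antipode (phi h) = phi (antipode h);
    gp_action : forall h x,
      iota (hgs_act S h x) =
        \sum_n phi h n * coset_eval ((sgval n)^-1%g base_coset) x
  }.

Definition gp_corresponds (S : hopf_galois_structure L)
    (N : {group {perm coset_space}}) : Prop :=
  [/\ regular_perm N, (lambdaG \subset 'N(N))%g
    & exists phi : {lrmorphism S -> permalg Lt N | in_alg Lt \; *:%R},
        is_gp_iso phi].

Definition almost_classically_galois (S : hopf_galois_structure L) : Prop :=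
  exists2 N : {group {perm coset_space}},
    gp_corresponds S N & ('C(N) \subset lambdaG)%g.

End GreitherPareigis.

(* S satisfies P and, up to isomorphism, is the only structure that does.     *)
Definition unique_up_to_iso (K : fieldType) (L : fieldExtType K)
    (P : hopf_galois_structure L -> Prop) (S : hopf_galois_structure L) :=
  P S /\ forall S', P S' -> hgs_isomorphic S' S.

(* Main.v *)
From HB Require Import structures.
Require Import Defs.
From mathcomp Require Import all_boot all_order all_fingroup all_algebra.
From mathcomp Require Import all_solvable all_field.

(** Let S correspond to the regular group N, so that S is the K-form Lt[N]^G of
    the group algebra Lt[N], and let S' be a structure whose Hopf algebra is
    isomorphic to that of S. Composing with the isomorphism makes S' a second
    K-form of the same Lt[N]; only its action on L may differ.

    By Galois descent a K-linear function on a K-form extends uniquely to an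
    Lt-linear function on Lt[N] ([form_ext], [form_sep_eq]). Hence, for x in L,
    iota (h . x) is the sum over n of the n-th coefficient of h times E_n x,
    where E_n only depends on the action. Since n is grouplike, E_n is an
    embedding of L in Lt over K, that is, a class X n in G/G'
    ([action_cosets]). The axioms of the action become conditions on the map
    X : N -> G/G': it satisfies X (m ^ l * n) = l (X m) for every l in lambda(G)
    that maps the base class to X n ([action_cosetM]); and, because L (x) S'
    fills the endomorphisms of L and distinct embeddings are independent, it is
    onto ([action_coset_surj]). For S itself the map is n |-> n^-1 (base class).

    The hypothesis that the centralizer of N lies in lambda(G) now decides
    everything. The centralizer of a regular group is transitive, so the l of
    the first condition can be taken in it; then m ^ l = m and the condition
    reads X (m * n) = l (X m). Comparing X with n |-> n^-1 (base class)
    therefore yields a bijection alpha of N which is an automorphism, and which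
    commutes with conjugation by lambda(G) ([regular_transfer]). The
    automorphism of Lt[N] induced by alpha is compatible with both descent
    data, so it restricts to a Hopf isomorphism S -> S' ([form_hopf_iso]), and
    by the choice of alpha it carries one action to the other. *)

Set Implicit Arguments.
Unset Strict Implicit.
Unset Printing Implicit Defensive.

Import GRing.Theory.
Local Open Scope ring_scope.

(** * Regular permutation groups *)

Section RegularGroup.
Variables (T : finType) (N : {group {perm T}}).
Hypothesis trN : [transitive N, on [set: T] | 'P]%g.
Hypothesis freeN : forall x, ('C_N[x | 'P] = 1)%g.

(** [subg] truncates a permutation outside N to 1; conjugates by elements of the
    normaliser of N are unaffected. *)
Definition conj_subg (l : {perm T}) (n : subg_of N) : subg_of N :=
  subg N (sgval n ^ l)%g.

Lemma conj_subgE l n :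
  l \in ('N(N))%g -> sgval (conj_subg l n) = (sgval n ^ l)%g.
Proof. by move=> nl; rewrite subgK // memJ_norm ?subgP. Qed.

Lemma regular_ex x y : exists n : subg_of N, sgval n x = y.
Proof.
have := atransP2 trN (in_setT x) (in_setT y).
by case=> n nN ->; exists (subg N n); rewrite subgK.
Qed.

Lemma regular_inj x : injective (fun n : subg_of N => sgval n x).
Proof.
move=> n m /= e; apply: val_inj; apply/eqP; rewrite eq_mulgV1; apply/eqP.
apply/set1gP; rewrite -(freeN x) inE groupM ?groupV ?subgP //=.
by apply/astab1P; rewrite /= apermE permM e permK.
Qed.

(** Identify T with N through n |-> n x. The centralizer then consists of the
    translations on the other side, so the permutation n x |-> n y belongs to
    it. *)
Lemma cent_transitive x y : exists2 z : {perm T}, z \in ('C(N))%g & z x = y.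
Proof.
have e t : exists n : subg_of N, sgval n x == t.
  by have [n /eqP] := regular_ex x t; exists n.
pose c t := xchoose (e t).
have cE t : sgval (c t) x = t by apply/eqP; exact: (xchooseP (e t)).
have inj_z : injective (fun t => sgval (c t) y).
  by move=> t u /(@regular_inj y) ct; rewrite -(cE t) ct cE.
exists (perm inj_z).
  apply/centP=> n nN; apply/permP=> t; rewrite !permM !permE /=.
  suff -> : c (n t) = (c t * subg N n)%g by rewrite permM subgK.
  by apply: (@regular_inj x); rewrite /= cE permM cE subgK.
rewrite permE; suff -> : c x = 1%g by rewrite perm1.
by apply: (@regular_inj x); rewrite /= cE perm1.
Qed.

(** The twisted rule satisfied by X determines X up to an automorphism of N. By
    regularity X n = (alpha n)^-1 b defines alpha. As n |-> n^-1 b obeys the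
    same rule as X, alpha (m ^ l * n) = alpha m ^ l * alpha n whenever
    l b = X n. For given n such an l exists in 'C(N), where conjugation is
    trivial: this is multiplicativity. Conversely any l in Lam satisfies
    l b = X n for some n, and cancelling alpha n gives equivariance. *)
Lemma regular_transfer (Lam : {set {perm T}}) (b : T) (X : subg_of N -> T) :
    Lam \subset ('N(N))%g -> ('C(N))%g \subset Lam ->
    (forall t, exists n, X n = t) ->
    (forall l n m, l \in Lam -> l b = X n ->
       X (conj_subg l m * n)%g = l (X m)) ->
  exists alpha : subg_of N -> subg_of N,
    [/\ bijective alpha, {morph alpha : m n / (m * n)%g},
        forall l m, l \in Lam -> alpha (conj_subg l m) = conj_subg l (alpha m)
      & forall n, X n = (sgval (alpha n))^-1%g b].
Proof.
move=> nLam cLam Xsurj XM.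
have e n : exists a : subg_of N, (sgval a)^-1%g b == X n.
  by have [a <-] := regular_ex b (X n); exists a^-1%g; rewrite /= invgK.
pose alpha n := xchoose (e n).
have aE n : (sgval (alpha n))^-1%g b = X n.
  by apply/eqP; exact: (xchooseP (e n)).
have inj0 : injective (fun a : subg_of N => (sgval a)^-1%g b).
  by move=> a a' /(@regular_inj b a^-1 a'^-1)%g /invg_inj.
have aM l n m : l \in Lam -> l b = X n ->
    alpha (conj_subg l m * n)%g = (conj_subg l (alpha m) * alpha n)%g.
  move=> lL lb; apply: inj0; rewrite /= aE XM // -aE.
  rewrite conj_subgE ?(subsetP nLam) // invMg permM (aE n) -lb -conjVg.
  by rewrite /conjg !permM permK.
have cE z m : z \in ('C(N))%g -> conj_subg z m = m.
  move=> zC; apply: subg_inj; rewrite conj_subgE ?(subsetP (cent_sub N)) //.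
  by rewrite conjgE -(centP zC _ (subgP m)) mulKg.
have morA : {morph alpha : m n / (m * n)%g}.
  move=> m n; have [z zC zb] := cent_transitive b (X n).
  by have := aM z n m (subsetP cLam z zC) zb; rewrite !cE.
exists alpha; split=> //.
  have surj a : exists n, alpha n == a.
    have [n Xn] := Xsurj ((sgval a)^-1%g b).
    by exists n; apply/eqP/inj0; rewrite /= aE.
  have surjK : cancel (fun a => xchoose (surj a)) alpha.
    by move=> a; apply/eqP; exact: (xchooseP (surj a)).
  exact: bij_can_bij (injF_bij (can_inj surjK)) _ surjK.
move=> l m lL; have [n Xn] := Xsurj (l b).
by apply: (mulIg (alpha n)); rewrite -morA aM.
Qed.
End RegularGroup.

(** * Coefficients in a group algebra *)

Section Coef.
Variables (R : fieldType) (T : finType) (N : {group {perm T}}).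
Implicit Types c d : permalg R N.

(** The values of a member of R[N], typed in the field R itself rather than in
    the regular module R^o of [permalg], so that products of coefficients are
    products of R. *)
Definition pcoef (c : permalg R N) (n : subg_of N) : R := c n.

Lemma pcoefP c d : pcoef c =1 pcoef d -> c = d.
Proof. by move=> cd; apply/ffunP. Qed.

Lemma pcoefD c d n : pcoef (c + d) n = pcoef c n + pcoef d n.
Proof. by rewrite /pcoef ffunE. Qed.

Lemma pcoefZ a c n : pcoef (a *: c) n = a * pcoef c n.
Proof. exact: palg_scaleE. Qed.

Lemma pcoef0 n : pcoef 0 n = 0.
Proof. by rewrite /pcoef ffunE. Qed.

Lemma pcoef_sum (I : finType) (f : I -> permalg R N) n :
  pcoef (\sum_i f i) n = \sum_i pcoef (f i) n.
Proof. by rewrite /pcoef sum_ffunE. Qed.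

Lemma pcoef_pbasis n m : pcoef (pbasis R n) m = (m == n)%:R.
Proof. by rewrite /pcoef ffunE. Qed.

Lemma pcoef_sum_pbasis (I : finType) (a : I -> R) (f : I -> subg_of N) m :
  pcoef (\sum_i a i *: pbasis R (f i)) m = \sum_i a i * (m == f i)%:R.
Proof.
by rewrite pcoef_sum; apply: eq_bigr => i _; rewrite pcoefZ pcoef_pbasis.
Qed.

Lemma pcoefM c d n :
  pcoef (c * d) n = \sum_m pcoef c m * pcoef d (n * m^-1)%g.
Proof. exact: palg_mulE. Qed.

End Coef.

(** * Descent from Lt to K *)

Section Trace.
Variables (K : fieldType) (Lt : splittingFieldType K).
Hypothesis galLt : galois 1 {:Lt}.
Local Notation G := (gal_of {:Lt}).

Lemma gal_sum_indep (d : G -> Lt) :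
  (forall a, \sum_(s : G) s a * d s = 0) -> forall s, d s = 0.
Proof.
move=> d0 s; apply: (@gal_independent _ _ _ predT d) => // a _.
by under eq_bigr do rewrite mulrC; exact: d0.
Qed.

(** A trace is fixed by the Galois group, hence lies in the base field. *)
Lemma gal_trace_scalar (a : Lt) : exists k : K, \sum_(s : G) s a = k%:A.
Proof.
have := mem_galTrace galLt (memvf a); rewrite /galTrace.
under eq_bigl => s do rewrite gal_kHom ?sub1v // k1AHom.
by case/vlineP=> k Tk; exists k.
Qed.
End Trace.

Section Form.
Variables (K : fieldType) (L : fieldExtType K) (Lt : splittingFieldType K).
Variables (iota : 'AHom(L, Lt)) (N : {group {perm coset_space iota}}).
Local Notation G := (gal_of {:Lt}).

Local Notation cj s := (@conj_subg _ N (lambda iota s)).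

(** Every clause of [is_gp_iso] that does not mention L. A K-Hopf algebra
    isomorphic to such an H is again one ([form_comp]), whatever its action
    on L. *)
Record is_form (H : hopfType K)
    (phi : {lrmorphism H -> permalg Lt N | in_alg Lt \; *:%R}) : Prop :=
  IsForm {
    form_inj : injective phi;
    form_image : forall c, (exists h, phi h = c) <-> (forall s, gp_act s c = c);
    form_comul : forall h, comul (phi h) =
      tlift_for (in_alg Lt) (fun a b => tens (phi a) (phi b)) (comul h);
    form_counit : forall h, counit (phi h) = in_alg Lt (counit h);
    form_antipode : forall h, antipode (phi h) = phi (antipode h) }.

Hypothesis galLt : galois 1 {:Lt}.
Hypothesis nN : (lambdaG iota \subset 'N(N))%g.

Lemma lambda_norm s : lambda iota s \in ('N(N))%g.
Proof. by apply: (subsetP nN); apply: imset_f; rewrite inE. Qed.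

Lemma lambda1 : lambda iota 1%g = 1%g.
Proof. by apply: (mulgI (lambda iota 1%g)); rewrite -lambdaM !mulg1. Qed.

Lemma cj1 n : cj 1%g n = n.
Proof.
by apply: subg_inj; rewrite conj_subgE ?lambda_norm // lambda1 conjg1.
Qed.

Lemma cjM s t n : cj (s * t)%g n = cj t (cj s n).
Proof.
by apply: subg_inj; rewrite !conj_subgE ?lambda_norm // lambdaM conjgM.
Qed.

Lemma cjK s : cancel (cj s) (cj s^-1)%g.
Proof. by move=> n; rewrite -cjM mulgV cj1. Qed.

Lemma cjVK s : cancel (cj s^-1)%g (cj s).
Proof. by move=> n; rewrite -cjM mulVg cj1. Qed.

Lemma gp_actE s (c : permalg Lt N) n :
  pcoef (gp_act s c) (cj s n) = s (pcoef c n).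
Proof.
rewrite /gp_act pcoef_sum_pbasis (bigD1 n) //= eqxx mulr1.
rewrite big1 ?addr0 // => m mn.
by rewrite -[subg _ _]/(cj s m) (can_eq (cjK s)) eq_sym (negPf mn) mulr0.
Qed.

Lemma gp_fixedP (c : permalg Lt N) :
  (forall s, gp_act s c = c) <->
  (forall s n, pcoef c (cj s n) = s (pcoef c n)).
Proof.
split=> [fc s n|fc s]; first by rewrite -{1}(fc s) gp_actE.
by apply: pcoefP=> n; rewrite -(cjVK s n) gp_actE -fc.
Qed.

Section OneForm.
Variables (H : hopfType K).
Variable phi : {lrmorphism H -> permalg Lt N | in_alg Lt \; *:%R}.
Hypothesis formH : is_form phi.

Lemma form_gal h s n : pcoef (phi h) (cj s n) = s (pcoef (phi h) n).
Proof.
have [fc _] := form_image formH (phi h).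
by apply: (gp_fixedP _).1; apply: fc; exists h.
Qed.

Lemma form_lift (c : permalg Lt N) :
  (forall s n, pcoef c (cj s n) = s (pcoef c n)) -> exists h, phi h = c.
Proof. by move=> fc; apply/(form_image formH)/gp_fixedP. Qed.

Lemma form_linear n : linear (fun h => pcoef (phi h) n : Lt).
Proof. by move=> a h k; rewrite linearP /= pcoefD pcoefZ mulr_algl. Qed.

Lemma formM h k n :
  pcoef (phi (h * k)) n =
    \sum_m pcoef (phi h) m * pcoef (phi k) (n * m^-1)%g.
Proof. by rewrite rmorphM pcoefM. Qed.

Local Notation e := (tnth (vbasis {:H})).

Lemma form_sum n (k : 'I_(\dim {:H}) -> K) :
  pcoef (phi (\sum_i k i *: e i)) n = \sum_i k i *: pcoef (phi (e i)) n.
Proof.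
rewrite linear_sum pcoef_sum; apply: eq_bigr => i _.
by rewrite linearZ /= pcoefZ mulr_algl.
Qed.

(** Vectors fixed by the semilinear action of G that are independent over K are
    independent over Lt. Multiplying a relation by a in Lt and summing its
    conjugates gives a relation with coefficients the traces of a * c i, which
    lie in K and therefore vanish; as a is arbitrary, the independence of
    automorphisms gives c i = 0. *)
Lemma form_indep (c : 'I_(\dim {:H}) -> Lt) :
  (forall n, \sum_i c i * pcoef (phi (e i)) n = 0) -> forall i, c i = 0.
Proof.
move=> c0 i.
have sc0 (s : G) a n : \sum_i s (a * c i) * pcoef (phi (e i)) n = 0.
  rewrite -(cjVK s n).
  under eq_bigr do rewrite form_gal -rmorphM -mulrA.
  by rewrite -rmorph_sum -mulr_sumr c0 mulr0 rmorph0.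
have tr0 a : \sum_(s : G) s (a * c i) = 0.
  have /fin_all_exists[k kE] i' := gal_trace_scalar galLt (a * c i').
  have k0 : \sum_i k i *: e i = 0.
    apply: (form_inj formH); rewrite linear0; apply: pcoefP=> n.
    rewrite form_sum pcoef0.
    under eq_bigr => i' _ do rewrite -mulr_algl -kE mulr_suml.
    by rewrite exchange_big big1 // => s _; exact: sc0.
  rewrite kE (freeP (basis_free (vbasisP _)) k) ?scale0r // -[RHS]k0.
  by apply: eq_bigr => j _; rewrite (tnth_nth 0).
have := gal_sum_indep (d := fun s : G => s (c i)) _ 1%g.
rewrite gal_id; apply=> a; rewrite -[RHS](tr0 a).
by apply: eq_bigr => s _; rewrite rmorphM.
Qed.

(** H spans Lt[N] over Lt: it contains the traces of a *: n for all a in Lt, and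
    by the independence of automorphisms a linear form vanishing on these
    vanishes at n. *)
Lemma form_sep (d : subg_of N -> Lt) :
  (forall h, \sum_n pcoef (phi h) n * d n = 0) -> forall n, d n = 0.
Proof.
move=> d0 n.
have := gal_sum_indep (d := fun s : G => d (cj s n)) _ 1%g.
rewrite cj1; apply=> a.
pose c : permalg Lt N := \sum_(s : G) s a *: pbasis Lt (cj s n).
have cE p : pcoef c p = \sum_(s : G) s a * (p == cj s n)%:R.
  exact: pcoef_sum_pbasis.
have [|h hc] := form_lift (c := c).
  move=> t p; rewrite !cE rmorph_sum (reindex_inj (mulIg t)) /=.
  apply: eq_bigr => s _.
  by rewrite cjM (can_eq (cjK t)) rmorphM rmorph_nat galM ?memvf.
rewrite -[RHS](d0 h) hc.
under [RHS]eq_bigr => p _ do rewrite cE mulr_suml.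
rewrite exchange_big; apply: eq_bigr => s _ /=.
rewrite (bigD1 (cj s n)) //= eqxx mulr1 big1 ?addr0 // => p pn.
by rewrite (negPf pn) mulr0 mul0r.
Qed.

Lemma form_sep_eq (u v : subg_of N -> Lt) :
  (forall h, \sum_n pcoef (phi h) n * u n = \sum_n pcoef (phi h) n * v n) ->
  u =1 v.
Proof.
move=> uv n; apply/eqP; rewrite -subr_eq0; apply/eqP; move: n.
apply: form_sep => h.
by under eq_bigr do rewrite mulrBr; rewrite sumrB uv subrr.
Qed.

(** The matrix of coefficients of a K-basis of H has independent rows, hence a
    right inverse over Lt, through which any K-linear function on H factors. A
    single operator [ext] serves all l, so that it applies to a family of
    functions l indexed by the elements of L. *)
Lemma form_ext :
  exists ext : (H -> Lt) -> subg_of N -> Lt, forall l, linear l ->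
    forall h, l h = \sum_n pcoef (phi h) n * ext l n.
Proof.
pose P := \matrix_(i < \dim {:H}, j < #|{: subg_of N}|)
  pcoef (phi (e i)) (enum_val j).
have : row_free P.
  apply: inj_row_free => v vP; apply/rowP=> i; rewrite mxE.
  apply: (form_indep (c := v 0)) => n.
  have := congr1 (fun A : 'M_(_, _) => A 0 (enum_rank n)) vP.
  rewrite !mxE => vPn; rewrite -[RHS]vPn.
  by apply: eq_bigr => j _; rewrite mxE enum_rankK.
case/row_freeP=> B PB.
exists (fun l n => (B *m (\col_i l (e i))) (enum_rank n) 0) => l ll h.
pose lL : {linear H -> Lt} := HB.pack l (GRing.isLinear.Build _ _ _ _ l ll).
have [k ->] : exists k : 'I_(\dim {:H}) -> K, h = \sum_i k i *: e i.
  exists (fun i => coord (vbasis {:H}) i h).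
  rewrite {1}(coord_vbasis (memvf h)).
  by apply: eq_bigr => i _; rewrite (tnth_nth 0).
rewrite -[l]/(lL : _ -> _) linear_sum.
under [RHS]eq_bigr do rewrite form_sum mulr_suml.
rewrite exchange_big; apply: eq_bigr => i _.
under eq_bigr do rewrite -scalerAl.
rewrite -scaler_sumr linearZ /=; congr (_ *: _).
have := congr1 (fun A : 'M_(_, _) => A i 0) (mulmxA P B (\col_i l (e i))).
rewrite PB mul1mx !mxE => <-.
rewrite [RHS](reindex_onto enum_val enum_rank) => [|n _]; last first.
  exact: enum_rankK.
apply: eq_big => [j|j _]; first by rewrite enum_valK eqxx.
by rewrite mxE enum_valK.
Qed.

(** The elements of N are grouplike; this expresses it through the
    comultiplication of H and the coefficients alone. *)
Lemma form_comul_pcoef h p q :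
  tlift (fun a b => pcoef (phi a) p * pcoef (phi b) q : Lt) (comul h) =
  pcoef (phi h) p *+ (p == q).
Proof.
pose F (c d : permalg Lt N) : Lt^o := pcoef c p * pcoef d q.
have Fl v : linear (F^~ v).
  by move=> a c d; rewrite /F pcoefD pcoefZ mulrDl -mulrA.
have Fr v : linear (F v).
  by move=> a c d; rewrite /F pcoefD pcoefZ mulrDr mulrCA.
pose FL : {linear tensor (permalg Lt N) (permalg Lt N) -> Lt^o} :=
  HB.pack (tlift F)
    (GRing.isLinear.Build _ _ _ _ (tlift F) (@tlift_linear _ _ _ _ F)).
have := congr1 FL (form_comul formH h).
rewrite [comul (phi h)]/(palg_comul (phi h)) /palg_comul linear_sum.
under eq_bigr => n _ do
  rewrite linearZ /= tliftE // /F !pcoef_pbasis -natrM mulnb.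
rewrite (bigD1 p) //= eqxx big1 ?addr0 => [|n np]; last first.
  by rewrite eq_sym (negPf np) scaler0.
rewrite [_ *: _](_ : _ = pcoef (phi h) p *+ (p == q)); last first.
  by rewrite [q == p]eq_sym -[RHS]mulr_natr.
rewrite -[tlift F _]/(FL _) => ->; rewrite /tlift_for linear_sum.
apply: eq_bigr => i _.
rewrite linear_sum; apply: eq_bigr => j _.
by rewrite linearZ /= tliftE // -[LHS]mulr_algl.
Qed.

(** H (x) H embeds in Lt[N] (x) Lt[N], whose coordinates are indexed by N * N:
    [form_indep] is applied to each factor in turn. *)
Lemma form_tensor_inj (t t' : tensor H H) :
  (forall p q,
     tlift (fun a b => pcoef (phi a) p * pcoef (phi b) q : Lt) t =
     tlift (fun a b => pcoef (phi a) p * pcoef (phi b) q : Lt) t') ->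
  t = t'.
Proof.
move=> tt'; apply/eqP; rewrite -subr_eq0.
have : forall p q, tlift (fun a b => pcoef (phi a) p * pcoef (phi b) q : Lt)
    (t - t') = 0.
  move=> p q; rewrite addrC -scaleN1r tlift_linear tt'.
  by rewrite scaleN1r addNr.
move: (t - t') => {tt' t'}t t0.
apply/eqP/matrixP=> i j; rewrite mxE.
have/eqP: (t i j)%:A = 0 :> Lt.
  move: j; apply: form_indep => q.
  rewrite -[RHS](@form_indep
    (fun i => \sum_j t i j *: pcoef (phi (e j)) q) _ i).
    by apply: eq_bigr => j _; rewrite mulr_algl.
  move=> p; rewrite -[RHS](t0 p q); apply: eq_bigr => i' _.
  rewrite mulr_suml; apply: eq_bigr => j _.
  by rewrite -scalerAl [_ * pcoef _ q]mulrC.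
by rewrite scaler_eq0 oner_eq0 orbF => /eqP.
Qed.

End OneForm.

(** * Embeddings of L and classes of G/G' *)

Lemma coset_eval_mul (s : G) (X : coset_space iota) x :
  coset_eval (Defs.coset_mul s X) x = s (coset_eval X x).
Proof.
have [t tX] : exists t, t \in val X.
  by case/rcosetsP: (valP X) => t _ ->; exists t; exact: rcoset_refl.
rewrite (coset_evalE _ tX) (@coset_evalE _ _ _ _ _ (t * s)%g) ?galM ?memvf //=.
by rewrite mem_rcoset mulgK.
Qed.

Lemma coset_eval_base x : coset_eval (base_coset iota) x = iota x.
Proof. by rewrite (@coset_evalE _ _ _ _ _ 1%g) ?gal_id //= group1. Qed.

Lemma coset_repr (X : coset_space iota) :
  exists s : G, X = Defs.coset_mul s (base_coset iota).
Proof. by case/rcosetsP: (valP X) => s _ XE; exists s; apply: val_inj. Qed.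

Lemma coset_eval_inj (X Y : coset_space iota) :
  coset_eval X =1 coset_eval Y -> X = Y.
Proof.
have [s ->] := coset_repr X; have [t ->] := coset_repr Y => st.
apply: val_inj; apply/rcoset_eqP; rewrite mem_rcoset /=.
rewrite gal_kHom ?subvf //; apply/kHomP_tmp; split=> [y|]; last first.
  by move=> x y _ _; rewrite rmorphM.
case/memv_imgP=> x _ ->; have := st x.
rewrite !coset_eval_mul coset_eval_base => stx.
by rewrite galM ?memvf // stx -galM ?memvf // mulgV gal_id.
Qed.

Lemma coset_evalM (X : coset_space iota) : {morph coset_eval X : x y / x * y}.
Proof. by move=> x y; rewrite /coset_eval !rmorphM. Qed.

Lemma coset_eval_neq (X Y : coset_space iota) :
  X != Y -> exists x, coset_eval X x != coset_eval Y x.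
Proof.
have [/forallP XY|] := boolP [forall j : 'I_(\dim {:L}),
  coset_eval X (vbasis {:L})`_j == coset_eval Y (vbasis {:L})`_j]; last first.
  by rewrite negb_forall => /existsP[j nXY] _; exists (vbasis {:L})`_j.
case/eqP; apply: coset_eval_inj => x.
rewrite (coord_vbasis (memvf x)) /coset_eval !linear_sum.
by apply: eq_bigr => j _; rewrite !linearZ; congr (_ *: _); apply/eqP/XY.
Qed.

(** Dedekind independence, for embeddings of L. An index i with X i distinct
    from Y is eliminated by comparing the relation at a * x with X i a times the
    relation at x, where a separates X i from Y. *)
Lemma cosets_indep (I : finType) (X : I -> coset_space iota) (c : I -> Lt) Y :
    (forall x, coset_eval Y x = \sum_i c i * coset_eval (X i) x) ->
  exists i, X i = Y.
Proof.
elim: (index_enum I) c => [|i r IHr] c.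
  move/(_ 1); rewrite big_nil /coset_eval !rmorph1 => /eqP.
  by rewrite oner_eq0.
have [XY|/eqP/coset_eval_neq[a XYa] YE] := X i =P Y; first by exists i.
have ne0 : coset_eval (X i) a - coset_eval Y a != 0 by rewrite subr_eq0.
apply: (IHr (fun j => (coset_eval (X i) a - coset_eval Y a)^-1 *
   (c j * (coset_eval (X i) a - coset_eval (X j) a)))) => x.
apply: (mulfI ne0); under eq_bigr do rewrite -mulrA.
rewrite -mulr_sumr mulVKf // mulrBl -coset_evalM !YE !big_cons mulrDr.
rewrite coset_evalM mulrCA [_ + _ * \sum_(j <- r) _]addrC addrKA.
rewrite mulr_sumr -sumrB; apply: eq_bigr => j _.
by rewrite coset_evalM mulrCA -!mulrA -mulrBr -mulrBl.
Qed.

(** Normality of Lt extends f \o iota^-1 from the image of L to an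
    automorphism. *)
Lemma embedding_coset (f : L -> Lt) :
    linear f -> f 1 = 1 -> {morph f : x y / x * y} ->
  exists X : coset_space iota, f =1 coset_eval X.
Proof.
move=> fl f1 fM.
pose fL : {linear L -> Lt} := HB.pack f (GRing.isLinear.Build _ _ _ _ f fl).
pose g : 'End(Lt) := (linfun fL \o iota^-1)%VF.
have gE x : g (iota x) = f x.
  by rewrite comp_lfunE lker0_lfunK ?AHom_lker0 // lfunE.
have [|||s _ sE] := @kHom_to_gal _ _ 1%AS (iota @: {:L})%AS {:Lt}%AS g.
- by rewrite sub1v subvf.
- by case/and3P: galLt.
- apply/kHomP_tmp; split=> [y /vlineP[k ->]|y z].
    by rewrite linearZ /= -(rmorph1 iota) gE f1 rmorph1.
  case/memv_imgP=> x _ -> /memv_imgP[x' _ ->].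
  by rewrite -rmorphM !gE.
exists (Defs.coset_mul s (base_coset iota)) => x.
by rewrite coset_eval_mul coset_eval_base -sE ?gE // memv_img ?memvf.
Qed.

(** * Actions on L as maps from N to G/G' *)

Section Action.
Variables (S : hopf_galois_structure L).
Variable phi : {lrmorphism S -> permalg Lt N | in_alg Lt \; *:%R}.
Hypothesis formS : is_form phi.
Local Notation e := (tnth (vbasis {:S})).

(** The coefficients E n of the action are embeddings of L: K-linearity,
    E n 1 = 1 and multiplicativity follow from the corresponding properties of
    the action by separating coefficients, the last because n is grouplike. *)
Lemma action_cosets : exists X : subg_of N -> coset_space iota,
  forall h x, iota (hgs_act S h x) =
    \sum_n pcoef (phi h) n * coset_eval (X n) x.
Proof.
have [ext extE] := form_ext formS.
pose E n x := ext (fun h => iota (hgs_act S h x)) n.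
have actE h x : iota (hgs_act S h x) = \sum_n pcoef (phi h) n * E n x.
  apply: (extE (fun h => iota (hgs_act S h x))) => a k l.
  by rewrite linearP add_lfunE scale_lfunE linearP.
suff /fin_all_exists[X XE] n : exists X : coset_space iota, E n =1 coset_eval X.
  by exists X => h x; rewrite actE; apply: eq_bigr => n _; rewrite XE.
apply: embedding_coset.
- move=> a x y; move: n; apply: (form_sep_eq formS) => h.
  rewrite -actE !linearP /= !actE.
  rewrite scaler_sumr -big_split; apply: eq_bigr => n _ /=.
  by rewrite mulrDr scalerAr.
- move: n; apply: (form_sep_eq formS) => h.
  rewrite -actE hgs_act_one linearZ rmorph1 /=.
  have := form_counit formS h; rewrite [LHS]/(palg_counit (phi h)) /palg_counit.
  rewrite -[X in _ = X -> _]/((counit h)%:A) => <-.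
  by apply: eq_bigr => m _; rewrite mulr1.
move=> x y; move: n; apply: (form_sep_eq formS) => h.
rewrite -actE hgs_act_mul /tlift_for.
(* Adding the zero off-diagonal terms brings in the comultiplication. *)
transitivity (\sum_p \sum_q
  (pcoef (phi h) p *+ (p == q)) * (E p x * E q y)); last first.
  apply: eq_bigr => p _; rewrite (bigD1 p) //= eqxx big1 ?addr0 // => q qp.
  by rewrite eq_sym (negPf qp) mul0r.
under [RHS]eq_bigr => p _.
  under eq_bigr => q _ do rewrite -(form_comul_pcoef formS) mulr_suml.
  rewrite exchange_big; over.
rewrite [RHS]exchange_big linear_sum; apply: eq_bigr => i _.
under [RHS]eq_bigr => p _.
  under eq_bigr => q _ do rewrite mulr_suml.
  rewrite exchange_big; over.
rewrite [RHS]exchange_big linear_sum; apply: eq_bigr => j _ /=.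
rewrite linearZ rmorphM /= !actE big_distrlr scaler_sumr; apply: eq_bigr => p _.
rewrite scaler_sumr; apply: eq_bigr => q _ /=.
by rewrite mulrACA scalerAl.
Qed.

Section Cosets.
Variable X : subg_of N -> coset_space iota.
Hypothesis actX : forall h x, iota (hgs_act S h x) =
  \sum_n pcoef (phi h) n * coset_eval (X n) x.

(** Compare the coefficients of n in (h * k) . x and h . (k . x): as X n is the
    class of s, the inner action is applied through s, which acts semilinearly
    on the coefficients of k and so conjugates its index. *)
Lemma action_cosetM s n m : X n = Defs.coset_mul s (base_coset iota) ->
  X (cj s m * n)%g = Defs.coset_mul s (X m).
Proof.
move=> Xn; apply: coset_eval_inj => x.
rewrite -[in RHS](cjK s m); move: (cj s m) => {}m; move: m.
apply: (form_sep_eq formS) => k.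
transitivity (coset_eval (X n) (hgs_act S k x)); last first.
  rewrite Xn coset_eval_mul coset_eval_base actX rmorph_sum.
  rewrite [RHS](reindex_inj (can_inj (cjK s))); apply: eq_bigr => m _ /=.
  by rewrite rmorphM /= -(form_gal formS) coset_eval_mul cjK.
move: n {Xn}; apply: (form_sep_eq formS) => h.
rewrite -actX -comp_lfunE -hgs_actM actX.
under [RHS]eq_bigr => p _ do rewrite (formM phi) mulr_suml.
rewrite exchange_big; apply: eq_bigr => n _ /=.
rewrite mulr_sumr [RHS](reindex_inj (mulIg n)); apply: eq_bigr => q _ /=.
by rewrite mulgK mulrA.
Qed.

(** The bijection of L (x) S with 'End(L), composed with iota. *)
Lemma action_end (T : 'End(L)) : exists c : subg_of N -> Lt,
  forall y, iota (T y) = \sum_n c n * coset_eval (X n) y.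
Proof.
have [g _ gK] := hgs_bij S.
exists (fun n => \sum_i \sum_j g T i j *:
  (iota (tnth (vbasis {:L}) i) * pcoef (phi (e j)) n)) => y.
rewrite -{1}(gK T) /tlift_for sum_lfunE linear_sum.
under [RHS]eq_bigr => n _ do rewrite mulr_suml.
rewrite exchange_big; apply: eq_bigr => i _ /=.
rewrite sum_lfunE linear_sum.
under [RHS]eq_bigr => n _ do rewrite mulr_suml.
rewrite exchange_big; apply: eq_bigr => j _ /=.
rewrite scale_lfunE linearZ comp_lfunE lfunE rmorphM /=.
rewrite actX mulr_sumr scaler_sumr.
by apply: eq_bigr => n _; rewrite mulrA scalerAl.
Qed.

(** Any class Y, as a map from L to Lt, is an Lt-combination of coordinate maps
    of L over K, hence of the X n by [action_end]; by independence it is one of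
    them. *)
Lemma action_coset_surj Y : exists n, X n = Y.
Proof.
have /fin_all_exists[c cE] (j : 'I_(\dim {:L})) : exists c : subg_of N -> Lt,
    forall y, (coord (vbasis {:L}) j y)%:A = \sum_n c n * coset_eval (X n) y.
  have lj : linear (fun y : L => (coord (vbasis {:L}) j y)%:A : L).
    by move=> a u v; rewrite linearP scalerDl scalerA.
  pose l : {linear L -> L} :=
    HB.pack (fun y : L => (coord (vbasis {:L}) j y)%:A : L)
      (GRing.isLinear.Build _ _ _ _ _ lj).
  have [c cE] := action_end (linfun l).
  exists c => y; rewrite -cE lfunE /=.
  by rewrite linearZ rmorph1.
apply: (cosets_indep (c := fun n =>
  \sum_(j < \dim {:L}) coset_eval Y (vbasis {:L})`_j * c j n)) => y.
rewrite {1}(coord_vbasis (memvf y)) /coset_eval !linear_sum.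
under [RHS]eq_bigr => n _ do rewrite mulr_suml.
rewrite exchange_big; apply: eq_bigr => j _ /=.
under eq_bigr do rewrite -mulrA.
by rewrite -mulr_sumr -cE mulr_algr !linearZ.
Qed.

End Cosets.

End Action.
End Form.

(** * Isomorphisms of Hopf algebras *)

Section HopfIso.
Variable K : fieldType.

Lemma tlift_for_tmap (U V U' V' : vectType K) (R : nzRingType)
    (nu : {rmorphism K -> R}) (W : lmodType R)
    (f : {linear U -> U'}) (g : {linear V -> V'}) (h : U' -> V' -> W) t :
    (forall v a u u', h (a *: u + u') v = nu a *: h u v + h u' v) ->
    (forall u a v v', h u (a *: v + v') = nu a *: h u v + h u v') ->
  tlift_for nu h (tmap f g t) = tlift_for nu (fun u v => h (f u) (g v)) t.
Proof.
move=> hl hr; have gl a s s' : tlift_for nu h (tmap f g (a *: s + s')) =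
    nu a *: tlift_for nu h (tmap f g s) + tlift_for nu h (tmap f g s').
  rewrite -tlift_for_linear; congr (tlift_for _ _ _).
  exact: tlift_for_linear.
rewrite (tlift_for_uniq (g := fun s => tlift_for nu h (tmap f g s)) gl t).
apply: eq_bigr => i _; apply: eq_bigr => j _; congr (_ *: _).
rewrite /tmap tliftE.
- by rewrite (tlift_forE hl hr).
- by move=> v a x y; rewrite linearP (tens_bilinear _ _).2.
by move=> v a x y; rewrite linearP (tens_bilinear _ _).1.
Qed.

Lemma tmap_comp (U V U' V' U'' V'' : vectType K)
    (f : {linear U -> U'}) (g : {linear V -> V'})
    (f' : {linear U' -> U''}) (g' : {linear V' -> V''}) t :
  tmap f' g' (tmap f g t) = tmap (f' \o f) (g' \o g) t.
Proof.
by apply: tlift_for_tmap => *; rewrite linearP;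
  [apply: (tens_bilinear _ _).2 | apply: (tens_bilinear _ _).1].
Qed.

Lemma tmap_id (U V : vectType K) (f : U -> U) (g : V -> V) (t : tensor U V) :
  f =1 id -> g =1 id -> tmap f g t = t.
Proof.
move=> fE gE; rewrite [RHS](@tlift_for_uniq _ _ _ _ idfun _ id) //.
by apply: eq_bigr => i _; apply: eq_bigr => j _; rewrite fE gE.
Qed.

Lemma hopf_iso_id (H : hopfType K) : is_hopf_iso (idfun : {lrmorphism H -> H}).
Proof.
split=> // [|h]; first by exists id.
by rewrite tmap_id.
Qed.

Lemma hopf_iso_inv (H H' : hopfType K) (f : {lrmorphism H -> H'}) :
  is_hopf_iso f ->
  exists2 g : {lrmorphism H' -> H}, is_hopf_iso g & cancel f g /\ cancel g f.
Proof.
case=> [[g fK gK] fC fU fA].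
have gl : linear g.
  by move=> a x y; apply: (can_inj fK); rewrite linearP /= !gK.
have gM : monoid_morphism g.
  by split=> [|x y]; apply: (can_inj fK); rewrite gK ?rmorph1 ?rmorphM /= ?gK.
pose G : {lrmorphism H' -> H} := HB.pack g (GRing.isLinear.Build _ _ _ _ g gl)
   (GRing.isMonoidMorphism.Build _ _ g gM).
exists G; last by [].
split=> [|h|h|h].
- by exists f.
- rewrite -{2}(gK h) fC (tmap_comp f f G G) tmap_id //; exact: fK.
- by rewrite -{2}(gK h) fU.
by rewrite -{2}(gK h) fA [RHS]fK.
Qed.

Lemma hopf_isomorphic_sym (H H' : hopfType K) :
  hopf_isomorphic H H' -> hopf_isomorphic H' H.
Proof. by case=> f /hopf_iso_inv[g gI _]; exists g. Qed.

Lemma hgs_isomorphic_sym (L : fieldExtType K) (S S' : hopf_galois_structure L) :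
  hgs_isomorphic S S' -> hgs_isomorphic S' S.
Proof.
case=> f [/hopf_iso_inv[g gI [fK gK]] fact]; exists g; split=> // h.
by rewrite -fact gK.
Qed.
End HopfIso.

(** * Comparison of two K-forms of the same group algebra *)

Section TwoForms.
Variables (K : fieldType) (L : fieldExtType K) (Lt : splittingFieldType K).
Variables (iota : 'AHom(L, Lt)) (N : {group {perm coset_space iota}}).
Local Notation G := (gal_of {:Lt}).
Local Notation cj s := (@conj_subg _ N (lambda iota s)).
Hypothesis galLt : galois 1 {:Lt}.
Hypothesis nN : (lambdaG iota \subset 'N(N))%g.

Lemma form_comp (H H' : hopfType K)
    (phi : {lrmorphism H -> permalg Lt N | in_alg Lt \; *:%R})
    (f : {lrmorphism H' -> H}) :
  is_form phi -> is_hopf_iso f ->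
  is_form (phi \o f : {lrmorphism H' -> permalg Lt N | in_alg Lt \; *:%R}).
Proof.
move=> [phiI phiG phiC phiU phiA] [fB fC fU fA]; split=> [||h|h|h] /=.
- exact: inj_comp phiI (bij_inj fB).
- move=> c; apply: iff_trans (phiG c).
  split=> [[h <-]|[h <-]]; first by exists (f h).
  by have [g _ gK] := fB; exists (g h); rewrite /= gK.
- rewrite phiC fC tlift_for_tmap // => *; rewrite linearP /=.
    exact: (tens_bilinear _ _).2.
  exact: (tens_bilinear _ _).1.
- by rewrite phiU fU.
by rewrite phiA fA.
Qed.

Lemma pcoef_antipode (c : permalg Lt N) n :
  pcoef (antipode c) n = pcoef c n^-1%g.
Proof.
rewrite [antipode c]/(palg_antipode c) /palg_antipode pcoef_sum.
rewrite (bigD1 n^-1%g) //= pcoefZ pcoef_pbasis invgK eqxx mulr1.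
rewrite big1 ?addr0 // => m mn; rewrite pcoefZ pcoef_pbasis eq_sym.
by rewrite -eq_invg_sym in mn *; rewrite (negPf mn) mulr0.
Qed.

Lemma form_counitE (H : hopfType K)
    (phi : {lrmorphism H -> permalg Lt N | in_alg Lt \; *:%R}) h :
  is_form phi -> \sum_n pcoef (phi h) n = in_alg Lt (counit h).
Proof. by move=> formH; rewrite -(form_counit formH h). Qed.

Section Transfer.
Variables (H H' : hopfType K).
Variable phi : {lrmorphism H -> permalg Lt N | in_alg Lt \; *:%R}.
Variable phi' : {lrmorphism H' -> permalg Lt N | in_alg Lt \; *:%R}.
Hypotheses (formH : is_form phi) (formH' : is_form phi').

(** Since alpha commutes with conjugation, c \o alpha is fixed by G when c is,
    so it comes from the other form. *)
Lemma form_pullback (alpha : subg_of N -> subg_of N) :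
    (forall s n, alpha (cj s n) = cj s (alpha n)) ->
  exists f : H -> H', forall h n,
    pcoef (phi' (f h)) n = pcoef (phi h) (alpha n).
Proof.
move=> alpha_cj.
have ex h : exists h', phi' h' == [ffun n => pcoef (phi h) (alpha n)].
  have [|h' h'E] := form_lift nN formH'
      (c := [ffun n => pcoef (phi h) (alpha n)]).
    move=> s n; rewrite /pcoef !ffunE -/(pcoef (phi h) _).
    by rewrite alpha_cj (form_gal nN formH).
  by exists h'; apply/eqP.
exists (fun h => xchoose (ex h)) => h n.
by rewrite (eqP (xchooseP (ex h))) {1}/pcoef ffunE.
Qed.
End Transfer.

(** All Hopf operations of a form are read off the coefficients, and an
    automorphism of the group respects the formulas that compute them. *)
Lemma form_hopf_iso (H H' : hopfType K)
    (phi : {lrmorphism H -> permalg Lt N | in_alg Lt \; *:%R})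
    (phi' : {lrmorphism H' -> permalg Lt N | in_alg Lt \; *:%R})
    (alpha : subg_of N -> subg_of N) :
    is_form phi -> is_form phi' -> bijective alpha ->
    {morph alpha : m n / (m * n)%g} ->
    (forall s n, alpha (cj s n) = cj s (alpha n)) ->
  exists2 f : {lrmorphism H -> H'}, is_hopf_iso f &
    forall h n, pcoef (phi' (f h)) n = pcoef (phi h) (alpha n).
Proof.
move=> formH formH' [beta alphaK betaK] alphaM alpha_cj.
have beta_cj s n : beta (cj s n) = cj s (beta n).
  by apply: (can_inj alphaK); rewrite alpha_cj !betaK.
have [f fE] := form_pullback formH formH' alpha_cj.
have [g gE] := form_pullback formH' formH beta_cj.
have phiI' h k : pcoef (phi' h) =1 pcoef (phi' k) -> h = k.
  by move=> hk; apply: (form_inj formH'); apply: pcoefP.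
have alpha1 : alpha 1%g = 1%g.
  by apply: (mulgI (alpha 1%g)); rewrite -alphaM !mulg1.
have alphaV n : alpha n^-1%g = (alpha n)^-1%g.
  by apply: (mulgI (alpha n)); rewrite -alphaM !mulgV alpha1.
have fl : linear f.
  move=> a x y; apply: phiI' => n.
  by rewrite fE !(form_linear phi, form_linear phi') !fE.
have fM : monoid_morphism f.
  split=> [|x y]; apply: phiI' => n.
    rewrite fE !rmorph1 -!pbasis1 !pcoef_pbasis -{1}alpha1.
    by rewrite (can_eq alphaK).
  rewrite fE !formM (reindex_inj (can_inj alphaK)) /=; apply: eq_bigr => m _.
  by rewrite !fE alphaM alphaV.
pose F : {lrmorphism H -> H'} := HB.pack f (GRing.isLinear.Build _ _ _ _ f fl)
   (GRing.isMonoidMorphism.Build _ _ f fM).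
exists F; last exact: fE.
split=> [|h|h|h].
- exists g => h.
    apply: (form_inj formH); apply: pcoefP => n.
    by rewrite gE fE betaK.
  by apply: phiI' => n; rewrite fE gE alphaK.
- apply: (form_tensor_inj galLt nN formH') => p q.
  rewrite (form_comul_pcoef formH') fE tlift_for_tmap.
  - rewrite -(can_eq alphaK) -(form_comul_pcoef formH).
    by apply: eq_bigr => i _; apply: eq_bigr => j _; rewrite !fE.
  - by move=> v a x y; rewrite (form_linear phi') mulrDl -scalerAl.
  by move=> v a x y; rewrite (form_linear phi') mulrDr -scalerAr.
- have := form_counitE h formH; rewrite (reindex_inj (can_inj alphaK)) /=.
  under eq_bigr do rewrite -fE; rewrite (form_counitE _ formH').
  exact: fmorph_inj.
apply: phiI' => n.
rewrite -(form_antipode formH') pcoef_antipode !fE.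
by rewrite -(form_antipode formH) pcoef_antipode alphaV.
Qed.

End TwoForms.

(** * Uniqueness of almost classically Galois structures *)

(** S' acts through the coset map X of the form phi \o f, and S through
    n |-> n^-1 (base class); the automorphism alpha that relates the two maps
    gives the required isomorphism. *)
Lemma acg_hgs_isomorphic (K : fieldType) (L : fieldExtType K)
    (Lt : splittingFieldType K) (iota : 'AHom(L, Lt)) (galLt : galois 1 {:Lt})
    (S S' : hopf_galois_structure L) :
  almost_classically_galois iota S -> hopf_isomorphic S' S ->
  hgs_isomorphic S S'.
Proof.
case=> N [/andP[trN /forallP freeN] nN [phi [phiI phiG phiC phiU phiA actS]]].
move=> cN [f fI].
have formS : is_form phi by [].
pose phi' : {lrmorphism S' -> permalg Lt N | in_alg Lt \; *:%R} := phi \o f.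
have formS' : is_form phi' := form_comp formS fI.
have [X actS'] := action_cosets galLt nN formS'.
have XM := action_cosetM nN formS' actS'.
have lambda_base s : lambda iota s (base_coset iota) =
    Defs.coset_mul s (base_coset iota) by rewrite permE.
have [] := regular_transfer (b := base_coset iota) (X := X) trN _ nN cN.
- by move=> x; apply/eqP.
- exact: (action_coset_surj actS').
- move=> _ n m /imsetP[s _ ->]; rewrite lambda_base => Xn.
  by rewrite XM // permE.
move=> alpha [alphaB alphaM alpha_cj XE].
have [|F FI FE] := form_hopf_iso galLt nN formS formS' alphaB alphaM.
  by move=> s n; apply: alpha_cj; apply: imset_f.
exists F; split=> // h; apply/lfunP=> x; apply: (fmorph_inj iota) => /=.
rewrite actS' actS [RHS](reindex alpha) /=; last exact: onW_bij.
by apply: eq_bigr => n _; rewrite FE XE.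
Qed.

Theorem proposition6 (K : fieldType) (L : fieldExtType K) (g : nat)
    (degL : \dim {:L} = g) (sepL : separable 1 {:L})
    (Lt : splittingFieldType K) (iota : 'AHom(L, Lt))
    (closL : is_galois_closure iota)
    (S : hopf_galois_structure L) (acgS : almost_classically_galois iota S) :
  (forall S' : hopf_galois_structure L,
     hopf_isomorphic (hgs_alg S) (hgs_alg S') -> hgs_isomorphic S S') /\
  unique_up_to_iso
    (fun S' : hopf_galois_structure L =>
       hopf_isomorphic (hgs_alg S') (hgs_alg S)) S.
Proof.
have [galLt _] := closL.
split=> [S' SS'|].
  by apply: (acg_hgs_isomorphic galLt acgS); exact: hopf_isomorphic_sym.
split=> [|S' SS']; first by exists idfun; exact: hopf_iso_id.
by apply: hgs_isomorphic_sym; exact: (acg_hgs_isomorphic galLt acgS).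
Qed.
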